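(* Let $X\in\mathbb{R}^{N\times d}$ be a matrix of observations. Assume that $G:=X^TX$ is invertible, and let $G=U\,\mathrm{diag}(\sigma)\,U^T$ be the diagonalized form ($U$ orthogonal, $\sigma=(\sigma_1,\dots,\sigma_d)$ the vector of eigenvalues of $G$). For $p\ge 1$, the $p$-bias constrained linear estimator $L_p(X)$ with bound $C$ can be expressed in the form $L_p(X)=\hat G^{-1}X^T$, where $\hat G$ is symmetric, simultaneously diagonalizable with $G$, and satisfies $G\preceq\hat G$. For the following special cases of $p$ we further have: (i) $p=1$ (nuclear norm): $\hat G=U\,\mathrm{diag}(\max(\sigma,\alpha))\,U^T$; (ii) $p=2$ (Frobenius norm): $\hat G=G+\alpha I_d$; (iii) $p=\infty$ (spectral norm): $\hat G=(1+\alpha)G$; where $\alpha\ge 0$ is determined by $C$, and $\max$ denotes the elementwise maximum, i.e. $\max(\sigma,\alpha)_i=\max(\sigma_i,\alpha)$.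
   Context: For a real matrix $M$ with singular values $\sigma_i(M)$, the Schatten $p$-norm is $\|M\|_p=\left(\sum_i\sigma_i(M)^p\right)^{1/p}$ for $1\le p<\infty$, and $\|M\|_\infty=\max_i\sigma_i(M)$ is the spectral norm. For $X\in\mathbb{R}^{N\times d}$, $p\ge 1$ (with $p=\infty$ allowed) and $C\ge 0$, the $p$-bias constrained linear estimator with bound $C$ is the minimal variance linear estimator whose bias operator $LX-I_d$ has Schatten $p$-norm at most $C$, that is, $$L_p(X)=\operatorname{argmin}\left\{\tfrac12\mathrm{Tr}(LL^T)\;:\;L\in\mathbb{R}^{d\times N},\ \|LX-I_d\|_p\le C\right\}.$$ $A\preceq B$ means that $B-A$ is non-negative definite.
   Formalization: When C is at least the Schatten p-norm of I_d, the estimator is 0 and (for d ≥ 1) no invertible Ĝ exists, so the claims about Ĝ and α are proved for C below that norm, and L_p(X)=0 is proved otherwise. *)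

(* Defs.v *)
From HB Require Import structures.
From mathcomp Require Import all_boot all_order all_algebra.
From mathcomp Require Import complex.
From mathcomp Require Import all_classical all_reals all_analysis.

Set Implicit Arguments.
Unset Strict Implicit.
Unset Printing Implicit Defensive.

Import Order.TTheory GRing.Theory Num.Theory.

Local Open Scope classical_set_scope.
Local Open Scope ring_scope.

Section Defs.
Context {R : realType}.

(* The eigenvalues of A repeated with algebraic multiplicity, in an
   unspecified order. The default [::] is only reached when the characteristic
   polynomial does not split over R; for symmetric A this never happens, see
   [symmetric_eigenvalues]. *)
Definition eigenvalues n (A : 'M[R]_n) : seq R :=
  xget [::] [set s | char_poly A = \prod_(x <- s) ('X - x%:P)].

(* There are n of these for an m x n matrix: when m < n the sequence contains
   n - m zeroes more than under the min(m, n) convention, which affects neither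
   of the sums and maxima below. *)
Definition singular_values m n (M : 'M[R]_(m, n)) : seq R :=
  [seq Num.sqrt x | x <- eigenvalues (M^T *m M)].

(* Only meant for 1 <= p; the value at -oo is arbitrary. *)
Definition schatten_norm (p : \bar R) m n (M : 'M[R]_(m, n)) : R :=
  match p with
  | r%:E => (\sum_(s <- singular_values M) s `^ r) `^ r^-1
  | +oo%E => \big[Num.max/0]_(s <- singular_values M) s
  | -oo%E => 0
  end.

Definition argmin T (f : T -> R) (A : set T) : set T :=
  [set x | A x /\ forall y, A y -> f x <= f y].

(* The argmin as a set: "the estimator is L" reads
   [bias_constrained_estimator p C X = [set L]]. *)
Definition bias_constrained_estimator (p : \bar R) (C : R) N d
    (X : 'M[R]_(N, d)) : set 'M[R]_(d, N) :=
  argmin (fun L => 2^-1 * \tr (L *m L^T))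
         [set L | schatten_norm p (L *m X - 1%:M) <= C].

Definition nonneg_definite n (A : 'M[R]_n) : Prop :=
  A^T = A /\ forall v : 'cV[R]_n, 0 <= (v^T *m A *m v) 0 0.

Definition loewner_le n (A B : 'M[R]_n) : Prop := nonneg_definite (B - A).

Lemma symmetric_eigenvalues n (A : 'M[R]_n) : A^T = A ->
  char_poly A = \prod_(x <- eigenvalues A) ('X - x%:P).
Proof.
move=> Asym; rewrite /eigenvalues; case: xgetP => [s _ // | nosplit].
pose toC := real_complex R.
pose B := map_mx toC A.
have Bherm : B \is hermsymmx.
  apply/is_hermitianmxP; rewrite expr0 scale1r; apply/matrixP => i j.
  by rewrite !mxE -{1}Asym mxE; exact/esym/(conjc_real (A j i)).
have /mxOverP dreal := hermitian_spectral_diag_real Bherm.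
have /orthomx_spectralP eqB := hermitian_normalmx Bherm.
set P := spectralmx B in eqB; set D := spectral_diag B in eqB dreal.
have Pu : P \in unitmx by exact: spectral_unit.
have PP : map_mx polyC (invmx P) *m map_mx polyC P = 1%:M.
  by rewrite -map_mxM mulVmx // map_mx1.
have charB : char_poly B = \prod_i ('X - (D 0 i)%:P).
  rewrite /char_poly.
  have -> : char_poly_mx B =
      map_mx polyC (invmx P) *m char_poly_mx (diag_mx D) *m map_mx polyC P.
    rewrite /char_poly_mx mulmxBr mulmxBl {1}eqB !map_mxM.
    by congr (_ - _); rewrite mul_mx_scalar -scalemxAl PP scalemx1.
  rewrite !det_mulmx mulrAC -det_mulmx PP det1 mul1r.
  rewrite -/(char_poly _) char_poly_trig ?diag_mx_is_trig //.
  by apply: eq_bigr => i _; rewrite mxE eqxx mulr1n.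
case: (nosplit [seq complex.Re (D 0 i) | i <- enum 'I_n]) => /=.
apply: (map_poly_inj toC).
rewrite [LHS]map_char_poly -/B charB rmorph_prod /= big_map big_enum /=.
apply: eq_bigr => i _; rewrite rmorphB /= map_polyX map_polyC /=.
by rewrite RRe_real.
Qed.

End Defs.

(* Main.v *)
Require Import Defs.
From HB Require Import structures.
From mathcomp Require Import all_boot all_order fingroup perm all_algebra.
From mathcomp Require Import complex.
From mathcomp Require Import all_classical all_reals all_analysis.
From mathcomp Require Import ring lra.

Set Implicit Arguments.
Unset Strict Implicit.
Unset Printing Implicit Defensive.

Import Order.TTheory GRing.Theory Num.Theory.
Import numFieldNormedType.Exports.

Local Open Scope classical_set_scope.
Local Open Scope ring_scope.

(* In the eigenbasis of G the problem is diagonal. By the singular value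
   decomposition E = \sum_j s_j q_j p_j^*, AM-GM and Bessel's inequality, the
   diagonal of E is dominated in absolute value by th *m s with th doubly
   substochastic, so by Jensen the l^p norm of the diagonal of E is at most the
   Schatten p-norm of E (pinching). Let e minimise \sum_i (1 - e_i)^2 / sigma_i
   on the l^p ball of radius C and put w_i = (1 - e_i) / sigma_i; convexity gives
   \sum_i w_i v_i <= \sum_i w_i e_i on the ball. Applied to the diagonal of
   U^T (1 - L X) U, this says that L0 = U diag(w) U^T X^T satisfies
   <L0, L - L0> >= 0 for every feasible L, so L0 is the unique minimiser, with
   Ghat = U diag(1 / w) U^T. Testing the same inequality against sign flips and
   coordinate swaps of e gives 0 <= e_i < 1, hence G <= Ghat; testing it against
   C w / |w| (p = 2), C times a basis vector (p = 1) and the constant vector C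
   (p = oo) identifies w. *)

(** * Characteristic polynomials of conjugates and of diagonal matrices *)

Lemma char_poly_conj (F : comNzRingType) n (P Q A : 'M[F]_n) :
  P *m Q = 1%:M -> char_poly (P *m A *m Q) = char_poly A.
Proof.
move=> PQ; pose c := map_mx (@polyC F).
have cPQ : c _ _ P *m c _ _ Q = 1%:M by rewrite -map_mxM PQ map_mx1.
rewrite /char_poly; have -> : char_poly_mx (P *m A *m Q) =
    c _ _ P *m char_poly_mx A *m c _ _ Q.
  rewrite /char_poly_mx mulmxBr mulmxBl !map_mxM mul_mx_scalar -scalemxAl cPQ.
  by rewrite scalemx1.
by rewrite !det_mulmx mulrAC -det_mulmx cPQ det1 mul1r.
Qed.

Lemma char_poly_diag (F : comNzRingType) n (v : 'rV[F]_n) :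
  char_poly (diag_mx v) = \prod_i ('X - (v 0 i)%:P).
Proof.
rewrite char_poly_trig ?diag_mx_is_trig //.
by apply: eq_bigr => i _; rewrite mxE eqxx mulr1n.
Qed.

(** * Domination of the diagonal by the singular values *)

Section DoublySubstochastic.
Local Open Scope sesquilinear_scope.
Variable K : numClosedFieldType.

Lemma mulmx_ctr_diag m n (A : 'M[K]_(m, n)) i :
  (A *m A ^t*) i i = \sum_j `|A i j| ^+ 2.
Proof. by rewrite mxE; apply: eq_bigr => j _; rewrite !mxE normCK. Qed.

Lemma mulmx_trc_diag m n (A : 'M[K]_(m, n)) j :
  (A ^t* *m A) j j = \sum_i `|A i j| ^+ 2.
Proof. by rewrite mxE; apply: eq_bigr => i _; rewrite !mxE normCK mulrC. Qed.

Lemma trmxCE m n (A : 'M[K]_(m, n)) i j : (A ^t*) i j = (A j i)^*.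
Proof. by rewrite !mxE. Qed.

Lemma trmxC_mul m n k (A : 'M[K]_(m, n)) (B : 'M[K]_(n, k)) :
  (A *m B) ^t* = B ^t* *m A ^t*.
Proof. by rewrite trmx_mul map_mxM. Qed.

(* Bessel's inequality: Q Q^* is a projection, so its diagonal entries h satisfy
   h^2 <= h. *)
Lemma partial_isometry_row_le1 m n (Q : 'M[K]_(m, n)) i :
  Q *m (Q ^t* *m Q) = Q -> \sum_j `|Q i j| ^+ 2 <= 1.
Proof.
move=> QQQ; rewrite -mulmx_ctr_diag; set H := Q *m Q ^t*.
have Hctr : H ^t* = H by rewrite trmxC_mul trmxCK.
have HH : H *m H ^t* = H by rewrite Hctr mulmxA -[H *m Q]mulmxA QQQ.
have Hii : H i i = \sum_j `|H i j| ^+ 2 by rewrite -mulmx_ctr_diag HH.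
have H0 : 0 <= H i i by rewrite Hii sumr_ge0 // => j _; rewrite exprn_ge0.
have : H i i ^+ 2 <= H i i.
  by rewrite [leRHS]Hii (bigD1 i) //= ger0_norm ?lerDl ?sumr_ge0 // => j _; rewrite exprn_ge0.
move: H0; rewrite le0r => /orP[/eqP -> //|H0].
by rewrite expr2 -[leRHS]mul1r ler_pM2r.
Qed.

Lemma normM_le_half (x y : K) : `|x * y| <= (`|x| ^+ 2 + `|y| ^+ 2) / 2.
Proof.
rewrite normrM ler_pdivlMr ?ltr0n // -subr_ge0.
have -> : `|x| ^+ 2 + `|y| ^+ 2 - `|x| * `|y| * 2 = (`|x| - `|y|) ^+ 2 by ring.
by rewrite real_exprn_even_ge0 // realB // normr_real.
Qed.

(** With [P] diagonalising [A^* A], the columns of [B = A P^*] are orthogonal of lengths [s j], so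
    [A i i] is the sum over [j] of [Q i j * s j * P j i], [Q] being [B] with normalised columns.
    AM-GM bounds [|Q i j * P j i|] by the mean of the squared moduli, whose row and column sums are
    at most 1. *)
Lemma diag_doubly_substochastic n (A : 'M[K]_n) :
  exists (s : 'I_n -> K) (th : 'I_n -> 'I_n -> K),
    [/\ (forall j, 0 <= s j) /\ (forall i j, 0 <= th i j),
        forall i, \sum_j th i j <= 1,
        forall j, \sum_i th i j <= 1,
        forall i, `|A i i| <= \sum_j th i j * s j &
        char_poly (A ^t* *m A) = \prod_j ('X - (s j ^+ 2)%:P)].
Proof.
set H := A ^t* *m A.
have Hherm : H \is hermsymmx.
  by apply/is_hermitianmxP; rewrite expr0 scale1r trmxC_mul trmxCK.
have /orthomx_spectralP eqH := hermitian_normalmx Hherm.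
set P := spectralmx H in eqH; set D := spectral_diag H in eqH.
have Pu : P \is unitarymx by exact: spectral_unitarymx.
have PPt : P *m P ^t* = 1%:M by exact/unitarymxP.
have PtP : P ^t* *m P = 1%:M by exact: mulmx1C.
rewrite invmx_unitary // in eqH.
pose B := A *m P ^t*.
have BB : B ^t* *m B = diag_mx D.
  rewrite trmxC_mul trmxCK mulmxA -[P *m _ *m _]mulmxA -/H eqH.
  by rewrite !mulmxA PPt mul1mx -mulmxA PPt mulmx1.
have DE j : D 0 j = \sum_i `|B i j| ^+ 2.
  by rewrite -mulmx_trc_diag BB mxE eqxx.
pose s j := sqrtC (D 0 j).
have D0 j : 0 <= D 0 j by rewrite DE sumr_ge0 // => i _; rewrite exprn_ge0.
have s0 j : 0 <= s j by rewrite sqrtC_ge0.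
have sK j : s j ^+ 2 = D 0 j by rewrite sqrtCK.
(* Division by zero gives 0, so [Q] has a zero column wherever [s j = 0]: it is a partial isometry,
   whose rows are bounded by Bessel's inequality. *)
pose Q := \matrix_(i, j) (B i j / s j).
have QE i j : Q i j = B i j / s j by rewrite [LHS]mxE.
have BQ i j : B i j = Q i j * s j.
  rewrite QE; have [sj0|sj0] := eqVneq (s j) 0; last by rewrite divfK.
  have /eqP := sK j; rewrite sj0 expr0n /= eq_sym DE psumr_eq0; last first.
    by move=> k _; rewrite exprn_ge0.
  by move=> /allP/(_ i (mem_index_enum _)); rewrite expf_eq0 normr_eq0 /=
    => /eqP ->; rewrite mulr0.
have QQ : Q ^t* *m Q = diag_mx (\row_j (s j != 0)%:R).
  apply/matrixP => i j; rewrite [LHS]mxE.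
  transitivity ((s i)^-1 * (B ^t* *m B) i j / s j).
    rewrite [(B ^t* *m B) i j]mxE mulr_sumr mulr_suml; apply: eq_bigr => k _.
    rewrite !trmxCE !QE rmorphM fmorphV /= (CrealP (ger0_real (s0 i))).
    by ring.
  rewrite BB !mxE; have [<-|_] := eqVneq i j; last by rewrite mulr0 mul0r.
  rewrite !mulr1n -sK; have [->|si0] := eqVneq (s i) 0; first by rewrite invr0 mulr0.
  by rewrite expr2 mulKf // mulfV.
have AE : A = B *m P by rewrite -mulmxA PtP mulmx1.
exists s, (fun i j => (`|Q i j| ^+ 2 + `|P j i| ^+ 2) / 2); split.
- by split => // i j; rewrite divr_ge0 // addr_ge0 // exprn_ge0.
- move=> i; rewrite -mulr_suml big_split /= ler_pdivrMr ?ltr0n // mul1r.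
  rewrite -mulmx_trc_diag PtP mxE eqxx -[2%:R]/(1 + 1) lerD2r.
  apply: partial_isometry_row_le1; rewrite QQ; apply/matrixP => k l.
  rewrite mul_mx_diag !mxE.
  by have [->|] := eqVneq (s l) 0; rewrite ?mulr1 // invr0 !mulr0.
- move=> j; rewrite -mulr_suml big_split /= ler_pdivrMr ?ltr0n // mul1r.
  rewrite -mulmx_ctr_diag PPt mxE eqxx -[2%:R]/(1 + 1) lerD2r.
  by rewrite -mulmx_trc_diag QQ !mxE eqxx lern1 leq_b1.
- move=> i; rewrite {1}AE mxE; apply: le_trans (ler_norm_sum _ _ _) _.
  apply: ler_sum => j _; rewrite BQ mulrAC normrM (ger0_norm (s0 j)).
  by rewrite ler_wpM2r // normM_le_half.
- rewrite eqH char_poly_conj // char_poly_diag.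
  by apply: eq_bigr => j _; rewrite sK.
Qed.
End DoublySubstochastic.

(** * Descent to real matrices *)

Section Pinching.
Variable R : realType.

(** The [s] and [th] found over [R[i]] are nonnegative there, hence real, so taking real parts
    preserves the inequalities and the factorisation. *)
Lemma diag_doubly_substochastic_real n (A : 'M[R]_n) :
  exists (s : 'I_n -> R) (th : 'I_n -> 'I_n -> R),
    [/\ (forall j, 0 <= s j) /\ (forall i j, 0 <= th i j),
        forall i, \sum_j th i j <= 1,
        forall j, \sum_i th i j <= 1,
        forall i, `|A i i| <= \sum_j th i j * s j &
        char_poly (A^T *m A) = \prod_j ('X - (s j ^+ 2)%:P)].
Proof.
pose toC := real_complex R.
have [s [th [[s0 th0] row1 col1 dom chi]]] :=
  diag_doubly_substochastic (map_mx toC A).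
have reK (x : R[i]) : 0 <= x -> toC (complex.Re x) = x.
  by move=> x0; rewrite /toC /= RRe_real // ger0_real.
have reD (I : finType) (f : I -> R[i]) :
    complex.Re (\sum_i f i) = \sum_i complex.Re (f i).
  by apply: (big_morph (@complex.Re R)) => // -[? ?] [? ?].
have reM (x y : R[i]) : 0 <= x -> complex.Re (x * y) = complex.Re x * complex.Re y.
  move=> x0; rewrite -{1}(reK _ x0); case: y => a b /=.
  by rewrite mul0r subr0.
have reS (x y : R[i]) : x <= y -> complex.Re x <= complex.Re y.
  by case: x y => [a b] [c d]; rewrite lecE => /andP[].
exists (fun j => complex.Re (s j)), (fun i j => complex.Re (th i j)); split.
- by split=> [j|i j]; apply: (reS 0).
- by move=> i; rewrite -reD; apply: (reS _ 1).
- by move=> j; rewrite -reD; apply: (reS _ 1).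
- move=> i; have /reS := dom i; rewrite reD mxE normc_def /=.
  rewrite expr0n addr0 sqrtr_sqr; under eq_bigr do rewrite reM //.
  by [].
- apply: (map_poly_inj toC); rewrite map_char_poly map_mxM -map_trmx.
  have -> : (map_mx toC A)^T = map_mx Num.conj (map_mx toC A)^T.
    apply/matrixP => i j; rewrite !mxE; exact/esym/conjc_real.
  rewrite chi rmorph_prod; apply: eq_bigr => j _.
  rewrite rmorphB /= map_polyX map_polyC -{1}(reK (s j)) //.
  by rewrite -rmorphXn.
Qed.
End Pinching.

(** * Convexity of real powers *)

Section PowR.
Variable R : realType.
Implicit Types a b c r t x y C : R.

(** Young's inequality for [x] and [c ^ (r - 1)] with conjugate exponents [r] and [r / (r - 1)]; the
    latter degenerates at [r = 1], treated apart. *)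
Lemma powR_tangent r c x : 1 <= r -> 0 <= c -> 0 <= x ->
  c `^ r + r * c `^ (r - 1) * (x - c) <= x `^ r.
Proof.
move=> r1 c0 x0; have r0 : 0 < r by exact: lt_le_trans r1.
have [->|r_neq1] := eqVneq r 1.
  by rewrite subrr powRr0 !powRr1 // !mul1r addrC subrK.
have r1lt : 0 < r - 1 by rewrite subr_gt0 lt_def r_neq1.
have cE : c * c `^ (r - 1) = c `^ r by rewrite mulr_powRB1.
have q0 : 0 < r / (r - 1) by rewrite divr_gt0.
have conj : r^-1 + (r / (r - 1))^-1 = 1.
  by field; rewrite !gt_eqF.
have := conjugate_powR x0 (powR_ge0 c (r - 1)) r0 q0 conj.
have -> : (c `^ (r - 1)) `^ (r / (r - 1)) = c `^ r.
  by rewrite -powRrM mulrCA divff ?mulr1 // gt_eqF.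
rewrite -(ler_pM2l r0) => young.
have eqr : r * (x `^ r / r + c `^ r / (r / (r - 1))) = x `^ r + (r - 1) * c `^ r.
  by field; rewrite !gt_eqF.
by move: young; rewrite eqr -cE; lra.
Qed.

(** Jensen for weights of total mass [T <= 1]: summing the tangents at [c] gives [c ^ r] plus the
    surplus [(r - 1) * (1 - T) * c ^ r]. *)
Lemma powR_sum_le r n (th s : 'I_n -> R) : 1 <= r ->
  (forall j, 0 <= th j) -> \sum_j th j <= 1 -> (forall j, 0 <= s j) ->
  (\sum_j th j * s j) `^ r <= \sum_j th j * s j `^ r.
Proof.
move=> r1 th0 th1 s0; set c := \sum_j _.
have c0 : 0 <= c by rewrite sumr_ge0 // => j _; rewrite mulr_ge0.
apply: (@le_trans _ _
    (\sum_j th j * (c `^ r + r * c `^ (r - 1) * (s j - c)))); last first.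
  by apply: ler_sum => j _; rewrite ler_wpM2l // powR_tangent.
have expand K L d : \sum_j th j * (K + L * (s j - d)) =
    (\sum_j th j) * (K - L * d) + L * \sum_j th j * s j.
  rewrite mulr_suml mulr_sumr -big_split /=.
  by apply: eq_bigr => j _; ring.
rewrite expand -/c -mulrA [_ * c]mulrC mulr_powRB1 ?(lt_le_trans _ r1) //.
rewrite -subr_ge0; set T := \sum_j _ in th1 *.
have -> : T * (c `^ r - r * c `^ r) + r * c `^ r - c `^ r =
    c `^ r * ((r - 1) * (1 - T)) by ring.
by rewrite !mulr_ge0 ?powR_ge0 ?subr_ge0.
Qed.

Lemma powR_inv_le x r C : 0 < r -> 0 <= x -> 0 <= C ->
  (x `^ r^-1 <= C) = (x <= C `^ r).
Proof.
move=> r0 x0 C0; have rI y : 0 <= y -> (y `^ r^-1) `^ r = y.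
  by move=> y0; rewrite -powRrM mulVf ?powRr1 // gt_eqF.
have rJ y : 0 <= y -> (y `^ r) `^ r^-1 = y.
  by move=> y0; rewrite -powRrM mulfV ?powRr1 // gt_eqF.
apply/idP/idP => h.
  by rewrite -[leLHS]rI // ge0_ler_powR ?nnegrE ?powR_ge0 // ltW.
by rewrite -[leRHS]rJ // ge0_ler_powR ?nnegrE ?powR_ge0 ?invr_ge0 // ltW.
Qed.

End PowR.

(** * Balls of the l^p norm: domination, convexity, compactness *)

Section LpBall.
Variable R : realType.
Implicit Types (r C : R) (p : \bar R).

(** The formula of [schatten_norm] on any sequence, so that a Schatten norm is by conversion the
    [lp_norm] of the singular values. Entries are meant to be nonnegative. *)
Definition lp_norm p (s : seq R) : R :=
  match p with
  | r%:E => (\sum_(x <- s) x `^ r) `^ r^-1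
  | +oo%E => \big[Num.max/0]_(x <- s) x
  | -oo%E => 0
  end.

Lemma bigmax_seq_le (s : seq R) C :
  (\big[Num.max/0]_(x <- s) x <= C) = (0 <= C) && all (<= C) s.
Proof.
elim: s => [|x s IH]; first by rewrite big_nil andbT.
by rewrite big_cons ge_max IH /= andbCA.
Qed.

Lemma lp_norm_perm p (s t : seq R) : perm_eq s t -> lp_norm p s = lp_norm p t.
Proof.
move=> st; case: p => [r||//] /=; first by rewrite (perm_big _ st).
have stE C : (\big[Num.max/0]_(x <- s) x <= C) = (\big[Num.max/0]_(x <- t) x <= C).
  by rewrite !bigmax_seq_le (perm_all _ st).
by apply: le_anti; rewrite stE lexx -stE lexx.
Qed.

Definition lp_ball p C n : set 'rV[R]_n :=
  [set v | lp_norm p [seq `|v 0 i| | i <- enum 'I_n] <= C].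

Lemma lp_ball_fin r C n (v : 'rV[R]_n) : 0 < r -> 0 <= C ->
  lp_ball r%:E C v <-> \sum_i `|v 0 i| `^ r <= C `^ r.
Proof.
move=> r0 C0; rewrite /lp_ball /= big_map big_enum /= powR_inv_le //.
by rewrite sumr_ge0 // => i _; rewrite powR_ge0.
Qed.

Lemma lp_ball_oo C n (v : 'rV[R]_n) : 0 <= C ->
  lp_ball +oo C v <-> forall i, `|v 0 i| <= C.
Proof.
move=> C0; rewrite /lp_ball /= bigmax_seq_le C0 /=; split => [/allP h i|h].
  by apply: h; apply: map_f; rewrite mem_enum.
by apply/allP => _ /mapP[i _ ->]; exact: h.
Qed.

(** For finite [p], the row sums allow Jensen in each row, and the column sums bound the total once
    the summations are exchanged. *)
Lemma lp_ball_dominated p C n (v w : 'rV[R]_n) (th : 'I_n -> 'I_n -> R) :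
  (1 <= p)%E -> 0 <= C -> (forall i j, 0 <= th i j) ->
  (forall i, \sum_j th i j <= 1) -> (forall j, \sum_i th i j <= 1) ->
  (forall i, `|w 0 i| <= \sum_j th i j * `|v 0 j|) ->
  lp_ball p C v -> lp_ball p C w.
Proof.
move=> p1 C0 th0 row1 col1 wv; case: p p1 => [r|_|//].
  rewrite lee_fin => r1; have r0 : 0 < r by exact: lt_le_trans r1.
  move/(lp_ball_fin v r0 C0) => vC; apply/lp_ball_fin => //.
  apply: le_trans vC; apply: (@le_trans _ _
      (\sum_i \sum_j th i j * `|v 0 j| `^ r)).
    apply: ler_sum => i _; apply: le_trans (powR_sum_le _ _ _ _) => //.
    rewrite ge0_ler_powR ?nnegrE ?(ltW r0) //.
    by rewrite sumr_ge0 // => j _; rewrite mulr_ge0.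
  rewrite exchange_big /=; apply: ler_sum => j _.
  by rewrite -mulr_suml ler_piMl // powR_ge0.
move/lp_ball_oo => /(_ C0) vC; apply/lp_ball_oo => // i.
apply: le_trans (wv i) _; apply: (@le_trans _ _ (\sum_j th i j * C)).
  by apply: ler_sum => j _; rewrite ler_wpM2l.
by rewrite -mulr_suml ler_piMl.
Qed.

(** A permutation matrix is doubly stochastic. This serves for sign changes, with [s = 1], and for
    coordinate swaps. *)
Lemma lp_ball_perm_le p C n (v w : 'rV[R]_n) (s : {perm 'I_n}) : (1 <= p)%E -> 0 <= C ->
  (forall i, `|w 0 i| <= `|v 0 (s i)|) -> lp_ball p C v -> lp_ball p C w.
Proof.
move=> p1 C0 wv.
apply: (@lp_ball_dominated _ _ _ _ _ (fun i j => (j == s i)%:R)) => //.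
- by move=> i; rewrite (bigD1 (s i)) //= eqxx big1 ?addr0 // => j /negPf ->.
- move=> j; rewrite (bigD1 (s^-1 j)%g) //= permKV eqxx big1 ?addr0 // => i.
  by rewrite -(inj_eq (@perm_inj _ s)) permKV eq_sym => /negPf ->.
- move=> i; rewrite (bigD1 (s i)) //= eqxx mul1r big1 ?addr0 // => j /negPf ->.
  by rewrite mul0r.
Qed.

Lemma lp_ball_convex p C n (v w : 'rV[R]_n) t : (1 <= p)%E -> 0 <= C ->
  0 <= t -> t <= 1 -> lp_ball p C v -> lp_ball p C w ->
  lp_ball p C (v + t *: (w - v)).
Proof.
move=> p1 C0 t0 t1.
have t1' : 0 <= 1 - t by rewrite subr_ge0.
have norm_le i : `|(v + t *: (w - v)) 0 i| <= (1 - t) * `|v 0 i| + t * `|w 0 i|.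
  have -> : (v + t *: (w - v)) 0 i = (1 - t) * v 0 i + t * w 0 i.
    by rewrite !mxE; ring.
  by apply: le_trans (ler_normD _ _) _; rewrite !normrM (ger0_norm t0) (ger0_norm t1').
case: p p1 => [r|_|//].
  rewrite lee_fin => r1; have r0 : 0 < r by exact: lt_le_trans r1.
  move=> /(lp_ball_fin _ r0 C0) vC /(lp_ball_fin _ r0 C0) wC.
  apply/lp_ball_fin => //; apply: (@le_trans _ _
      (\sum_i ((1 - t) * `|v 0 i| `^ r + t * `|w 0 i| `^ r))).
    apply: ler_sum => i _.
    have := powR_sum_le (n := 2) (th := fun j => if j == 0 then 1 - t else t)
      (s := fun j => if j == 0 then `|v 0 i| else `|w 0 i|) r1.
    rewrite !big_ord_recl !big_ord0 /= !addr0 => h.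
    apply: le_trans (h _ _ _).
    - by rewrite ge0_ler_powR ?nnegrE ?(ltW r0) // addr_ge0 // mulr_ge0.
    - by move=> j; case: ifP.
    - by rewrite subrK.
    - by move=> j; case: ifP.
  by rewrite big_split /= -!mulr_sumr; nra.
move=> /(lp_ball_oo _ C0) vC /(lp_ball_oo _ C0) wC; apply/lp_ball_oo => // i.
by apply: le_trans (norm_le i) _; have := vC i; have := wC i; nra.
Qed.

Lemma continuous_sum_fin (T : topologicalType) n (f : 'I_n -> T -> R) :
  (forall i, continuous (f i)) -> continuous (fun x => \sum_i f i x).
Proof.
move=> fc; rewrite (_ : (fun x => _) = \sum_i f i); last first.
  by apply/funext => x; rewrite fct_sumE.
apply: (big_ind (fun g : T -> R => continuous g)) => //.
- by move=> x; exact: cvg_cst.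
- by move=> g h gc hc x; apply: cvgD; [exact: gc|exact: hc].
Qed.

Lemma continuous_affine_fun (T : topologicalType) (f : T -> R) a b c :
  continuous f -> continuous (fun x => a + b * (f x - c)).
Proof.
move=> fc x; apply: cvgD; first exact: cvg_cst.
by apply: cvgM; [exact: cvg_cst|apply: cvgB; [exact: fc|exact: cvg_cst]].
Qed.

(* x |-> x^r is the supremum of its tangents, so that the ball is cut out by
   conditions that are affine in the |v_i|. *)
Lemma closed_lp_ball p C n : (1 <= p)%E -> 0 <= C ->
  closed (@lp_ball p C n).
Proof.
move=> p1 C0.
have normc i : continuous (fun v : 'rV[R]_n => `|v 0 i|).
  move=> v; exact: (continuous_comp (@coord_continuous R 1 n 0 i v) (@norm_continuous R R^o _)).
case: p p1 => [r|_|//].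
  rewrite lee_fin => r1; have r0 : 0 < r by exact: lt_le_trans r1.
  pose f (c v : 'rV[R]_n) := \sum_i
    (`|c 0 i| `^ r + r * `|c 0 i| `^ (r - 1) * (`|v 0 i| - `|c 0 i|)).
  have -> : @lp_ball r%:E C n =
      \bigcap_(c in setT) f c @^-1` [set x | x <= C `^ r].
    apply/seteqP; split => v.
      move/(lp_ball_fin _ r0 C0) => vC c _ /=.
      by apply: le_trans vC; apply: ler_sum => i _; rewrite powR_tangent.
    move/(_ v I) => /= vC; apply/lp_ball_fin => //.
    apply: le_trans vC; apply: ler_sum => i _.
    by rewrite subrr mulr0 addr0.
  apply: closed_bigI => c _.
  apply: (continuous_closedP (f c)).1 _ _ (@closed_le _ (C `^ r)).
  by apply: continuous_sum_fin => i; exact: continuous_affine_fun.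
have -> : @lp_ball +oo%E C n =
    \bigcap_(i in setT) (fun v : 'rV[R]_n => `|v 0 i|) @^-1` [set x | x <= C].
  apply/seteqP; split => v; first by move=> /(lp_ball_oo _ C0) vC i _ /=.
  by move=> vC; apply/lp_ball_oo => // i; exact: (vC i I).
apply: closed_bigI => i _.
exact: (continuous_closedP _).1 (normc i) _ (@closed_le _ C).
Qed.

Lemma lp_ball_bounded p C n (v : 'rV[R]_n) i : (1 <= p)%E -> 0 <= C ->
  lp_ball p C v -> `|v 0 i| <= C.
Proof.
move=> p1 C0; case: p p1 => [r|_|//]; last by move/(lp_ball_oo _ C0).
rewrite lee_fin => r1; have r0 : 0 < r by exact: lt_le_trans r1.
move=> /(lp_ball_fin _ r0 C0); apply: contraTT; rewrite -!ltNge => Cv.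
rewrite (bigD1 i) //=; apply: (@lt_le_trans _ _ (`|v 0 i| `^ r)).
  by rewrite gt0_ltr_powR ?nnegrE.
by rewrite lerDl sumr_ge0 // => j _; rewrite powR_ge0.
Qed.

Lemma compact_lp_ball p C n : (1 <= p)%E -> 0 <= C -> compact (@lp_ball p C n).
Proof.
move=> p1 C0.
have cube : compact [set v : 'rV[R]_n | forall i, v ord0 i \in `[- C, C]].
  apply: (@rV_compact _ _ (fun=> `[- C, C]%classic)) => _.
  exact: segment_compact.
apply: subclosed_compact (@closed_lp_ball p C n p1 C0) cube _ => v vC i.
by rewrite in_itv /= -ler_norml; exact: lp_ball_bounded vC.
Qed.

End LpBall.

(** * Critical points of the diagonal problem *)

Section Critical.
Variables (R : realType) (n : nat) (sg : 'I_n -> R) (p : \bar R) (C : R).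
Hypotheses (sg_gt0 : forall i, 0 < sg i) (p1 : (1 <= p)%E) (C0 : 0 <= C).

(** Up to the factor -2, the gradient of the objective at [e]; these numbers become the eigenvalues
    of the inverse of [Ghat]. *)
Definition weight (e : 'rV[R]_n) i := (1 - e 0 i) / sg i.

(* First-order optimality for the minimisation of
   \sum_i (1 - e_i)^2 / sg_i over the ball. *)
Definition critical (e : 'rV[R]_n) := lp_ball p C e /\
  forall v, lp_ball p C v -> \sum_i weight e i * (v 0 i - e 0 i) <= 0.

Lemma lp_ball0 : lp_ball p C (0 : 'rV[R]_n).
Proof.
case: p p1 => [r|_|//].
  rewrite lee_fin => r1; have r0 : 0 < r by exact: lt_le_trans r1.
  apply/(lp_ball_fin _ r0 C0); rewrite big1 ?powR_ge0 // => i _.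
  by rewrite mxE normr0 powR0 // gt_eqF.
by apply/(lp_ball_oo _ C0) => i; rewrite mxE normr0.
Qed.

Lemma critical_exists : exists e, critical e.
Proof.
(* The zeroes give each term the shape of [continuous_affine_fun]. *)
pose f (v : 'rV[R]_n) := \sum_i (0 + (sg i)^-1 * ((v 0 i - 1) ^+ 2 - 0)).
have fc : continuous f.
  apply: continuous_sum_fin => i; apply: continuous_affine_fun => v.
  have cc : continuous (fun x : R => (0 + 1 * (x - 1)) ^+ 2).
    move=> x; apply: (@continuous_comp _ _ _ (fun x : R => 0 + 1 * (x - 1))
      (fun y : R => y ^+ 2)); last exact: exprn_continuous.
    by apply: continuous_affine_fun => y; exact: cvg_id.
  rewrite (_ : (fun _ => _) = (fun x : R => (0 + 1 * (x - 1)) ^+ 2) \o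
    (fun v : 'rV[R]_n => v 0 i)); last first.
    by apply/funext => x /=; rewrite add0r mul1r.
  exact: continuous_comp (@coord_continuous R 1 n 0 i v) (cc _).
have [e] := EVT_min_rV (ex_intro _ _ lp_ball0) (@compact_lp_ball R p C n p1 C0)
  (continuous_subspaceT fc).
rewrite inE => eC emin; exists e; split => // v vC.
set L := \sum_i _; pose Q := \sum_i (v 0 i - e 0 i) ^+ 2 / sg i.
have Q0 : 0 <= Q by rewrite sumr_ge0 // => i _; rewrite divr_ge0 ?sqr_ge0 ?ltW.
have fE t : f (e + t *: (v - e)) = f e - 2 * t * L + t ^+ 2 * Q.
  rewrite /f /L /Q !mulr_sumr -sumrN -!big_split /=; apply: eq_bigr => i _.
  by rewrite /weight !mxE; ring.
rewrite leNgt; apply/negP => L0.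
(* This [t] satisfies [t * Q = (1 - t) * L], so the change [- 2 * t * L + t ^+ 2 * Q] of the
   objective is [- t * (1 + t) * L < 0], while [t <= 1] keeps the point in the ball. *)
pose t := L / (Q + L).
have QL0 : 0 < Q + L by rewrite ltr_wpDl.
have t0 : 0 < t by rewrite divr_gt0.
have t1 : t <= 1 by rewrite ler_pdivrMr // mul1r lerDr.
have := emin (e + t *: (v - e)); rewrite inE fE => /(_ _)/wrap[].
  exact: lp_ball_convex (ltW t0) t1 eC vC.
apply/negP; rewrite -ltNge.
have tE : t * (Q + L) = L by rewrite divfK // gt_eqF.
nra.
Qed.

Section Bounds.
Variable e : 'rV[R]_n.
Hypotheses (crit : critical e) (out1 : ~ lp_ball p C (const_mx 1 : 'rV[R]_n)).

(** Flipping the sign of coordinate [i] stays in the ball and yields [(1 - e_i) * e_i >= 0]. *)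
Lemma critical_ge0_le1 i : 0 <= e 0 i <= 1.
Proof.
have [eC vi] := crit.
pose v := \row_j (if j == i then - e 0 i else e 0 j).
have /vi : lp_ball p C v.
  apply: (@lp_ball_perm_le _ _ _ _ e _ 1%g) eC => // j.
  by rewrite perm1 mxE; have [->|_] := eqVneq j i; rewrite ?normrN.
rewrite (bigD1 i) //= big1 ?addr0; last first.
  by move=> j /negPf ji; rewrite mxE ji subrr mulr0.
rewrite mxE eqxx /weight mulrAC pmulr_lle0 ?invr_gt0 //.
by move=> ?; apply/andP; split; nra.
Qed.

(** If [e_i = 1] then [w_i = 0], so swapping [e_i] and [e_j] yields [(1 - e_j) ^ 2 <= 0]; thus [e]
    would be the all-ones vector, which is outside the ball. *)
Lemma critical_lt1 i : 0 <= e 0 i < 1.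
Proof.
have /andP[e0 e1] := critical_ge0_le1 i; rewrite e0 /= lt_neqAle e1 andbT.
apply/eqP => ei1; have [eC vi] := crit; apply: out1.
suff -> : const_mx 1 = e by [].
apply/rowP => j; rewrite mxE; have [->|ji] := eqVneq j i; first by rewrite ei1.
have /andP[ej0 ej1] := critical_ge0_le1 j.
have /vi : lp_ball p C (\row_k e 0 (tperm i j k)).
  by apply: (@lp_ball_perm_le _ _ _ _ e _ (tperm i j)) eC => // k; rewrite mxE.
rewrite (bigD1 i) //= (bigD1 j) //= big1 ?addr0; last first.
  by move=> k /andP[ki kj]; rewrite mxE tpermD 1?eq_sym // subrr mulr0.
rewrite !mxE tpermL tpermR /weight ei1 subrr !mul0r add0r mulrAC.
by rewrite pmulr_lle0 ?invr_gt0 // => ?; nra.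
Qed.

Lemma weight_gt0 i : 0 < weight e i.
Proof. by rewrite divr_gt0 // subr_gt0; case/andP: (critical_lt1 i). Qed.

Lemma weight_le i : weight e i <= (sg i)^-1.
Proof.
have /andP[e0 _] := critical_lt1 i.
by rewrite /weight ler_piMl ?invr_ge0 ?(ltW (sg_gt0 i)) // gerBl.
Qed.

Lemma weight_inv i : (weight e i)^-1 * (1 - e 0 i) = sg i.
Proof.
have /andP[_ e1] := critical_lt1 i.
by rewrite invf_div divfK // subr_eq0 eq_sym lt_eqF.
Qed.

End Bounds.
End Critical.

(** * The weights for the exponents infinity, 1 and 2 *)

Section SpecialExponents.
Variables (R : realType) (n : nat) (sg : 'I_n -> R) (C : R).
Hypotheses (sg_gt0 : forall i, 0 < sg i) (C0 : 0 <= C).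
Variable e : 'rV[R]_n.
Local Notation w := (weight sg e).
Local Notation out1 p := (~ lp_ball p C (const_mx 1 : 'rV[R]_n)).
Local Notation norms := [seq `|e 0 i| | i <- enum 'I_n].

(** In dimension 0 the all-ones vector is 0, which lies in the ball; so some index exists. *)
Lemma not_lp_ball_ord p : (1 <= p)%E -> out1 p -> 'I_n.
Proof.
move=> p1 out; case: (pickP (@predT 'I_n)) => [i _|no]; first exact: i.
exfalso; apply: out; suff -> : const_mx 1 = 0 :> 'rV[R]_n by exact: lp_ball0.
by apply/rowP => i; have := no i.
Qed.

(** Tested against the constant vector [C], the optimality sum has nonnegative terms and total at
    most 0, so each term vanishes. *)
Lemma critical_oo : critical sg +oo C e -> out1 +oo%E ->
  (forall i, e 0 i = C) /\ lp_norm +oo norms = C.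
Proof.
move=> crit out.
have p1 : (1 <= +oo :> \bar R)%E by rewrite leey.
have w0 := weight_gt0 sg_gt0 p1 C0 crit out.
have e0 i : 0 <= e 0 i by case/andP: (critical_lt1 sg_gt0 p1 C0 crit out i).
have [/(lp_ball_oo _ C0) eC vi] := crit.
have eE i : e 0 i = C.
  have /vi : lp_ball +oo C (const_mx C : 'rV[R]_n).
    by apply/(lp_ball_oo _ C0) => j; rewrite mxE ger0_norm.
  have term0 j : 0 <= w j * ((const_mx C : 'rV[R]_n) 0 j - e 0 j).
    rewrite mulr_ge0 ?(ltW (w0 j)) // mxE subr_ge0.
    by apply: le_trans (eC j); exact: ler_norm.
  rewrite (bigD1 i) //= => sum_le0.
  have : w i * ((const_mx C : 'rV[R]_n) 0 i - e 0 i) <= 0.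
    apply: le_trans sum_le0; rewrite lerDl sumr_ge0 // => j _; exact: term0.
  rewrite pmulr_rle0 // mxE subr_le0 => Ce.
  apply: le_anti; rewrite Ce andbT.
  by apply: le_trans (eC i); exact: ler_norm.
split=> //; apply: le_anti; rewrite bigmax_seq_le C0 /=; apply/andP; split.
  by apply/allP => _ /mapP[i _ ->]; rewrite /= eE ger0_norm.
have i0 := not_lp_ball_ord p1 out.
have : \big[Num.max/0]_(x <- norms) x <= \big[Num.max/0]_(x <- norms) x by [].
rewrite bigmax_seq_le => /andP[_ /allP/(_ `|e 0 i0|)].
rewrite eE ger0_norm //; apply; apply/mapP; exists i0; rewrite ?mem_enum //.
by rewrite eE ger0_norm.
Qed.

(** Let [m] maximise [w]. Testing against [C] times the basis vector at [m] forces [\sum_i e_i = C],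
    and [e_i = 0] unless [w_i = w_m]. With [alpha = 1 / w_m], either [1 / w_i = alpha >= sg i], or
    [1 / w_i = sg i >= alpha]. *)
Lemma critical_1 : critical sg 1%E C e -> out1 1%E ->
  (exists2 alpha, 0 <= alpha & forall i, (w i)^-1 = Num.max (sg i) alpha) /\
  lp_norm 1 norms = C.
Proof.
move=> crit out.
have p1 : (1 <= 1%:E :> \bar R)%E by [].
have w0 := weight_gt0 sg_gt0 p1 C0 crit out.
have e0 i : 0 <= e 0 i by case/andP: (critical_lt1 sg_gt0 p1 C0 crit out i).
have wE := weight_inv sg_gt0 p1 C0 crit out.
have [/(lp_ball_fin _ ltr01 C0) eC vi] := crit.
have normE : \sum_i `|e 0 i| `^ 1 = \sum_i e 0 i.
  by apply: eq_bigr => i _; rewrite powRr1 // ger0_norm.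
rewrite normE powRr1 // in eC.
have i0 := not_lp_ball_ord p1 out.
have [m _ mmax] := @arg_maxP _ _ _ i0 xpredT w isT.
have /vi : lp_ball 1 C (\row_i (C * (i == m)%:R) : 'rV[R]_n).
  apply/(lp_ball_fin _ ltr01 C0); rewrite (bigD1 m) //= mxE eqxx mulr1.
  rewrite big1 ?addr0 ?ger0_norm // => i /negPf im.
  by rewrite mxE im mulr0 normr0 powR0 // oner_eq0.
have -> : \sum_i w i * ((\row_i (C * (i == m)%:R) : 'rV[R]_n) 0 i - e 0 i) =
    w m * (C - \sum_i e 0 i) + \sum_i (w m - w i) * e 0 i.
  rewrite mulrBr mulr_sumr -addrA -sumrN -big_split /=.
  have -> : w m * C = \sum_i w i * (C * (i == m)%:R).
    rewrite (bigD1 m) //= eqxx mulr1 big1 ?addr0 // => i /negPf ->.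
    by rewrite !mulr0.
  by rewrite -big_split /=; apply: eq_bigr => i _; rewrite mxE; ring.
have slack i : 0 <= (w m - w i) * e 0 i.
  by rewrite mulr_ge0 // subr_ge0; exact: mmax.
have first0 : 0 <= w m * (C - \sum_i e 0 i).
  by rewrite mulr_ge0 ?subr_ge0 ?(ltW (w0 m)).
have slacks : 0 <= \sum_i (w m - w i) * e 0 i by rewrite sumr_ge0.
move=> le0.
have /eqP sumE : w m * (C - \sum_i e 0 i) = 0 by apply/le_anti; lra.
rewrite mulf_eq0 gt_eqF //= subr_eq0 in sumE.
have /eqP slack0 : \sum_i (w m - w i) * e 0 i = 0 by apply/le_anti; lra.
rewrite psumr_eq0 // in slack0.
split; last by rewrite /= big_map big_enum /= normE -(eqP sumE) invr1 powRr1.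
exists (w m)^-1; first by rewrite invr_ge0 ltW.
move=> i; have /allP/(_ i (mem_index_enum _)) := slack0.
rewrite mulf_eq0 subr_eq0 => /orP[/eqP wmi|/eqP ei].
  rewrite -wmi max_r // -(wE i) -wmi ler_piMr ?invr_ge0 ?(ltW (w0 m)) //.
  by rewrite gerBl.
have sgE : (w i)^-1 = sg i by rewrite -(wE i) ei subr0 mulr1.
by rewrite -sgE max_l // lef_pV2 ?posrE //; exact: mmax.
Qed.

(** Testing against [a * w], of norm [C], forces equality in Cauchy-Schwarz: [e = a * w]. Then
    [sg i = (1 - e_i) / w_i = 1 / w_i - a], so [alpha = a]. *)
Lemma critical_2 : critical sg 2%:E C e -> out1 2%:E%E ->
  (exists2 alpha, 0 <= alpha & forall i, (w i)^-1 = sg i + alpha) /\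
  lp_norm 2%:E norms = C.
Proof.
move=> crit out.
have p1 : (1 <= 2%:E :> \bar R)%E by rewrite lee_fin ler1n.
have w0 := weight_gt0 sg_gt0 p1 C0 crit out.
have wE := weight_inv sg_gt0 p1 C0 crit out.
have r0 : 0 < 2 :> R by [].
have sqE x : `|x| `^ 2 = x ^+ 2 :> R.
  by rewrite powR_mulrn // real_normK // num_real.
have [/(lp_ball_fin _ r0 C0) eC vi] := crit.
have normE (v : 'rV[R]_n) : \sum_i `|v 0 i| `^ 2 = \sum_i v 0 i ^+ 2.
  by apply: eq_bigr => i _.
rewrite normE powR_mulrn // in eC.
have i0 := not_lp_ball_ord p1 out.
pose W := \sum_i w i ^+ 2; pose S := Num.sqrt W.
have W0 : 0 < W.
  rewrite /W (bigD1 i0) //= ltr_pwDl ?exprn_gt0 // sumr_ge0 // => i _.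
  by rewrite sqr_ge0.
have S0 : 0 < S by rewrite sqrtr_gt0.
have SS : S ^+ 2 = W by rewrite sqr_sqrtr // ltW.
pose a := C / S; have aS : a * S = C by rewrite divfK // gt_eqF.
have /vi : lp_ball 2%:E C (\row_i (a * w i)).
  apply/(lp_ball_fin _ r0 C0); rewrite normE powR_mulrn // -aS exprMn SS mulr_sumr.
  by apply: ler_sum => i _; rewrite mxE exprMn.
have -> : \sum_i w i * ((\row_i (a * w i)) 0 i - e 0 i) =
    a * W - \sum_i w i * e 0 i.
  rewrite mulr_sumr -sumrN -big_split /=; apply: eq_bigr => i _.
  by rewrite mxE; ring.
move=> le0.
have a0 : 0 <= a by rewrite divr_ge0 // ltW.
have aW : a * a * W = C ^+ 2 by rewrite -SS -aS; ring.
(* Follows from [|e|^2 <= C^2], [a^2 * |w|^2 = C^2] and [<w, e> >= a * |w|^2]. *)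
have dist : \sum_i (e 0 i - a * w i) ^+ 2 <= 0.
  have -> : \sum_i (e 0 i - a * w i) ^+ 2 =
      \sum_i e 0 i ^+ 2 - 2 * a * (\sum_i w i * e 0 i) + a * a * W.
    rewrite !mulr_sumr -sumrN -!big_split /=; apply: eq_bigr => i _; ring.
  by nra.
have eE i : e 0 i = a * w i.
  have : \sum_i (e 0 i - a * w i) ^+ 2 == 0.
    by rewrite eq_le dist sumr_ge0 // => j _; rewrite sqr_ge0.
  rewrite psumr_eq0; last by move=> j _; rewrite sqr_ge0.
  move=> /allP/(_ i (mem_index_enum _)).
  by rewrite sqrf_eq0 subr_eq0 => /eqP.
split.
  exists a => // i; rewrite -(wE i) eE mulrBr mulr1 mulrCA mulVf ?mulr1 ?subrK //.
  by rewrite gt_eqF.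
rewrite /= big_map big_enum /= normE.
have -> : \sum_i e 0 i ^+ 2 = C ^+ 2.
  by rewrite -aW mulr_sumr; apply: eq_bigr => i _; rewrite eE; ring.
by rewrite powR12_sqrt ?sqr_ge0 // sqrtr_sqr ger0_norm.
Qed.

End SpecialExponents.

(** * Matrices diagonal in a fixed orthonormal basis *)

Section OrthogonalConjugation.
Variables (R : comUnitRingType) (n : nat) (U : 'M[R]_n).
Hypothesis UtU : U^T *m U = 1%:M.
Implicit Types v : 'rV[R]_n.

Definition orth_diag v := U *m diag_mx v *m U^T.

Lemma orth_mulVmx : U *m U^T = 1%:M. Proof. exact: mulmx1C. Qed.

Lemma orth_diagK v : U^T *m orth_diag v *m U = diag_mx v.
Proof. by rewrite !mulmxA UtU mul1mx -mulmxA UtU mulmx1. Qed.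

Lemma tr_orth_diag v : (orth_diag v)^T = orth_diag v.
Proof. by rewrite !trmx_mul trmxK tr_diag_mx mulmxA. Qed.

Lemma orth_diagM v1 v2 :
  orth_diag v1 *m orth_diag v2 = orth_diag (\row_i (v1 0 i * v2 0 i)).
Proof.
rewrite /orth_diag -!mulmxA [U^T *m (U *m _)]mulmxA UtU mul1mx.
by rewrite [diag_mx v1 *m (_ *m _)]mulmxA mulmx_diag.
Qed.

Lemma orth_diagB v1 v2 : orth_diag v1 - orth_diag v2 = orth_diag (v1 - v2).
Proof. by rewrite /orth_diag raddfB /= mulmxBr mulmxBl. Qed.

Lemma orth_diagD v1 v2 : orth_diag v1 + orth_diag v2 = orth_diag (v1 + v2).
Proof. by rewrite /orth_diag raddfD /= mulmxDr mulmxDl. Qed.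

Lemma orth_diag_const a : orth_diag (const_mx a) = a%:M.
Proof.
by rewrite /orth_diag diag_const_mx mul_mx_scalar -scalemxAl orth_mulVmx scalemx1.
Qed.

Lemma orth_diagZ a v : orth_diag (a *: v) = a *: orth_diag v.
Proof. by rewrite /orth_diag linearZ /= -scalemxAr -scalemxAl. Qed.

Lemma orth_diag_inv v1 v2 : (forall i, v1 0 i * v2 0 i = 1) ->
  orth_diag v1 \in unitmx /\ invmx (orth_diag v1) = orth_diag v2.
Proof.
move=> v12; have inv12 : orth_diag v1 *m orth_diag v2 = 1%:M.
  rewrite orth_diagM -orth_diag_const; congr orth_diag.
  by apply/rowP => i; rewrite !mxE v12.
have [v1u _] := mulmx1_unit inv12.
by split=> //; rewrite -[RHS](mulKmx v1u) inv12 mulmx1.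
Qed.

End OrthogonalConjugation.

(** * Schatten norms, pinching and the trace objective *)

Section Schatten.
Variable R : realType.

(** Unique factorisation makes [eigenvalues], whose order is unspecified, a permutation of the
    [s i ^+ 2], and [lp_norm] ignores order. The [s i] may have any sign. *)
Lemma schatten_lp p m n (M : 'M[R]_(m, n)) (s : 'I_n -> R) :
  char_poly (M^T *m M) = \prod_i ('X - (s i ^+ 2)%:P) ->
  schatten_norm p M = lp_norm p [seq `|s i| | i <- enum 'I_n].
Proof.
move=> chi; have -> : schatten_norm p M = lp_norm p (singular_values M) by [].
apply: lp_norm_perm.
have -> : [seq `|s i| | i <- enum 'I_n] =
    [seq Num.sqrt x | x <- [seq s i ^+ 2 | i <- enum 'I_n]].
  by rewrite -[RHS]map_comp; apply: eq_map => i /=; rewrite sqrtr_sqr.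
apply: perm_map; apply: prod_XsubC_eq.
rewrite -symmetric_eigenvalues ?trmx_mul ?trmxK // chi.
by rewrite big_map big_enum.
Qed.

Section Conjugation.
Variables (n : nat) (U : 'M[R]_n).
Hypothesis UtU : U^T *m U = 1%:M.

Lemma schatten_orth_diag p v :
  schatten_norm p (orth_diag U v) = lp_norm p [seq `|v 0 i| | i <- enum 'I_n].
Proof.
apply: schatten_lp; rewrite tr_orth_diag orth_diagM // char_poly_conj.
  by rewrite char_poly_diag; apply: eq_bigr => i _; rewrite mxE expr2.
exact: orth_mulVmx.
Qed.

(** Conjugation by [U] preserves the singular values, and these dominate the diagonal of the
    conjugate. *)
Lemma schatten_pinching p C (E : 'M[R]_n) : (1 <= p)%E -> 0 <= C ->
  schatten_norm p E <= C -> lp_ball p C (\row_i (U^T *m E *m U) i i).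
Proof.
move=> p1 C0 EC; set F := U^T *m E *m U.
have [s [th [[s0 th0] row1 col1 dom chi]]] := diag_doubly_substochastic_real F.
have FF : F^T *m F = U^T *m (E^T *m E) *m U.
  rewrite !trmx_mul trmxK !mulmxA; congr (_ *m _ *m _).
  by rewrite -!mulmxA orth_mulVmx // mulmx1.
apply: (@lp_ball_dominated _ p C n (\row_j s j) _ th) => //.
  by move=> i; rewrite mxE; under eq_bigr do rewrite mxE ger0_norm //; exact: dom.
have -> : lp_ball p C (\row_j s j) =
    (lp_norm p [seq `|s j| | j <- enum 'I_n] <= C) :> Prop.
  by congr (is_true (lp_norm p _ <= C)); apply: eq_map => j; rewrite mxE.
rewrite -(@schatten_lp p n n E s) // -chi FF char_poly_conj //.
Qed.

Lemma orth_diag_nonneg (v : 'rV[R]_n) : (forall i, 0 <= v 0 i) -> nonneg_definite (orth_diag U v).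
Proof.
move=> v0; split=> [|x]; first exact: tr_orth_diag.
have -> : x^T *m orth_diag U v *m x = (U^T *m x)^T *m (diag_mx v *m (U^T *m x)).
  by rewrite trmx_mul trmxK !mulmxA.
rewrite mxE sumr_ge0 // => i _.
by rewrite mul_diag_mx [(_^T) _ _]mxE [X in _ * X]mxE mulrCA mulr_ge0 // -expr2 sqr_ge0.
Qed.

End Conjugation.

Lemma mxtrace_mul_tr m n (A : 'M[R]_(m, n)) :
  \tr (A *m A^T) = \sum_i \sum_j A i j ^+ 2.
Proof.
apply: eq_bigr => i _; rewrite mxE; apply: eq_bigr => j _.
by rewrite mxE expr2.
Qed.

Lemma mxtrace_mul_tr_ge0 m n (A : 'M[R]_(m, n)) : 0 <= \tr (A *m A^T).
Proof.
by rewrite mxtrace_mul_tr !sumr_ge0 // => i _; rewrite sumr_ge0 // => j _; rewrite sqr_ge0.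
Qed.

Lemma mxtrace_mul_tr_eq0 m n (A : 'M[R]_(m, n)) : \tr (A *m A^T) <= 0 -> A = 0.
Proof.
move=> trA; have : \tr (A *m A^T) == 0 by rewrite eq_le trA mxtrace_mul_tr_ge0.
rewrite mxtrace_mul_tr psumr_eq0; last first.
  by move=> i _; rewrite sumr_ge0 // => j _; rewrite sqr_ge0.
move=> /allP A0; apply/matrixP => i j; rewrite mxE.
have := A0 i (mem_index_enum _); rewrite /= psumr_eq0; last first.
  by move=> k _; rewrite sqr_ge0.
by move=> /allP/(_ j (mem_index_enum _)); rewrite sqrf_eq0 => /eqP.
Qed.

(** With [D = L - L0], the squared Frobenius norm of [L] is [|L0|^2 + 2 * <L0, D> + |D|^2]. The
    middle term is nonnegative by assumption; the last one gives uniqueness. *)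
Lemma argmin_trace_eq m n (A : set 'M[R]_(m, n)) L0 : A L0 ->
  (forall L, A L -> 0 <= \tr (L0 *m (L - L0)^T)) ->
  argmin (fun L => 2^-1 * \tr (L *m L^T)) A = [set L0].
Proof.
move=> AL0 vi.
have trE L : \tr (L *m L^T) = \tr (L0 *m L0^T) +
    2 * \tr (L0 *m (L - L0)^T) + \tr ((L - L0) *m (L - L0)^T).
  move: (L - L0) (subrKC L0 L) => D <-.
  have -> : 2 * \tr (L0 *m D^T) = \tr (L0 *m D^T) + \tr (D *m L0^T).
    by rewrite -(mxtrace_tr (D *m _)) trmx_mul trmxK mulr_natl.
  by rewrite linearD /= mulmxDl !mulmxDr !linearD /= !addrA.
apply/seteqP; split=> [L [AL Lmin]|_ ->].
  apply/eqP; rewrite -subr_eq0; apply/eqP/mxtrace_mul_tr_eq0.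
  have := Lmin _ AL0; rewrite ler_pM2l ?invr_gt0 // trE.
  by have := vi _ AL; lra.
split=> // L AL; rewrite ler_pM2l ?invr_gt0 // [leRHS]trE.
by have := vi _ AL; have := mxtrace_mul_tr_ge0 (L - L0); lra.
Qed.

End Schatten.

(** * Reduction of the estimator to the diagonal problem *)

Section Estimator.
Variables (R : realType) (N d : nat) (X : 'M[R]_(N, d)) (U : 'M[R]_d).
Variables (sigma : 'rV[R]_d) (p : \bar R) (C : R).
Hypotheses (UtU : U^T *m U = 1%:M) (GE : X^T *m X = orth_diag U sigma).
Hypotheses (p1 : (1 <= p)%E) (C0 : 0 <= C).

(** [diag_mx sigma] is the Gram matrix of [X *m U], so its entries are sums of squares;
    invertibility excludes 0. *)
Lemma gram_eigenvalue_gt0 : X^T *m X \in unitmx -> forall i, 0 < sigma 0 i.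
Proof.
move=> Gu i; have sE : (X *m U)^T *m (X *m U) = diag_mx sigma.
  by rewrite trmx_mul -(orth_diagK UtU) -GE !mulmxA.
rewrite lt_def; apply/andP; split.
  have : diag_mx sigma \in unitmx.
    have [Uu Utu] := mulmx1_unit UtU.
    by rewrite -(orth_diagK UtU) -GE !unitmx_mul Uu Utu Gu.
  rewrite unitmxE det_diag unitfE => /prodf_neq0; exact.
have -> : sigma 0 i = ((X *m U)^T *m (X *m U)) i i by rewrite sE mxE eqxx.
by rewrite mxE sumr_ge0 // => j _; rewrite mxE -expr2 sqr_ge0.
Qed.

Lemma bias_constrained_critical e :
  (forall i, 0 < sigma 0 i) -> critical (fun i => sigma 0 i) p C e ->
  let w := \row_i weight (fun i => sigma 0 i) e i in
  orth_diag U w *m (X^T *m X) - 1%:M = orth_diag U (- e) /\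
  bias_constrained_estimator p C X = [set orth_diag U w *m X^T].
Proof.
move=> s0 [eC vi] w.
have wE i : w 0 i = weight (fun i => sigma 0 i) e i by rewrite mxE.
have bias : orth_diag U w *m (X^T *m X) - 1%:M = orth_diag U (- e).
  rewrite GE orth_diagM // -(orth_diag_const UtU) orth_diagB; congr orth_diag.
  apply/rowP => i; rewrite !mxE /weight divfK ?gt_eqF //.
  by rewrite addrC addKr.
split=> //; apply: argmin_trace_eq => [|L LC] /=.
  rewrite -mulmxA bias schatten_orth_diag //.
  suff -> : [seq `|(- e) 0 i| | i <- enum 'I_d] = [seq `|e 0 i| | i <- enum 'I_d].
    by [].
  by apply: eq_map => i; rewrite mxE normrN.
have vC := schatten_pinching UtU p1 C0 LC.
set M := U^T *m _ *m U in vC.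
(* The difference of two estimators times [X] is the difference of their biases; in the eigenbasis
   the candidate's bias is [- diag_mx e]. *)
have FE : U^T *m ((L - orth_diag U w *m X^T) *m X) *m U = M + diag_mx e.
  have -> : (L - orth_diag U w *m X^T) *m X =
      (L *m X - 1%:M) - orth_diag U (- e).
    by rewrite -bias opprB addrA subrK mulmxBl -mulmxA.
  by rewrite mulmxBr mulmxBl orth_diagK // raddfN opprK.
set D := L - _ in FE *.
(* The factor [X^T] of the candidate turns [D] into [D *m X], of which the trace sees only the
   diagonal in the eigenbasis; this is why pinching is enough. *)
have -> : \tr (orth_diag U w *m X^T *m D^T) = \sum_i w 0 i * (M i i + e 0 i).
  have -> : \tr (orth_diag U w *m X^T *m D^T) =
      \tr (diag_mx w *m (U^T *m (D *m X) *m U)^T).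
    rewrite /orth_diag -!mulmxA mxtrace_mulC -!mulmxA; congr (\tr (_ *m _)).
    by rewrite !trmx_mul trmxK !mulmxA.
  rewrite FE /mxtrace; apply: eq_bigr => i _.
  by rewrite mul_diag_mx !mxE eqxx mulr1n.
(* Optimality of [e] is tested at the diagonal of [U^T (1 - L X) U], hence the sign. *)
have /vi : lp_ball p C (\row_i - M i i).
  apply: (@lp_ball_perm_le _ _ _ _ _ _ 1%g) vC => // i.
  by rewrite perm1 !mxE normrN.
rewrite -oppr_ge0 -sumrN => /le_trans -> //; apply: ler_sum => i _.
by rewrite wE mxE -opprD mulrN opprK.
Qed.

End Estimator.

(** * Closed form of the estimator for general and special exponents *)

Theorem theorem2 (R : realType) (N d : nat) (X : 'M[R]_(N, d))
    (U : 'M[R]_d) (sigma : 'rV[R]_d) (p : \bar R) (C : R) :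
  let G := X^T *m X in
  G \in unitmx ->
  U^T *m U = 1%:M ->
  G = U *m diag_mx sigma *m U^T ->
  (1 <= p)%E ->
  0 <= C ->
  (* limiting case alpha = +oo, the only one in which no Ghat exists *)
  (schatten_norm p (1%:M : 'M[R]_d) <= C ->
     bias_constrained_estimator p C X = [set 0]) /\
  (C < schatten_norm p (1%:M : 'M[R]_d) ->
   exists Ghat : 'M[R]_d,
    [/\ Ghat \in unitmx,
        bias_constrained_estimator p C X = [set invmx Ghat *m X^T],
        Ghat^T = Ghat,
        codiagonalizable [:: G; Ghat] &
        loewner_le G Ghat] /\
    [/\ (* (i) *)
        p = 1%E -> exists alpha : R,
          [/\ 0 <= alpha,
              Ghat = U *m diag_mx (\row_i Num.max (sigma 0 i) alpha) *m U^T &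
              schatten_norm p (invmx Ghat *m G - 1%:M) = C],
        (* (ii) *)
        p = 2%:E -> exists alpha : R,
          [/\ 0 <= alpha,
              Ghat = G + alpha%:M &
              schatten_norm p (invmx Ghat *m G - 1%:M) = C] &
        (* (iii) *)
        p = +oo%E -> exists alpha : R,
          [/\ 0 <= alpha,
              Ghat = (1 + alpha) *: G &
              schatten_norm p (invmx Ghat *m G - 1%:M) = C]]).
Proof.
move=> G Gu UtU; rewrite -/(orth_diag U sigma) => GE p1 C0.
have s0 := gram_eigenvalue_gt0 UtU GE Gu.
have schatten1 : schatten_norm p (1%:M : 'M[R]_d) =
    lp_norm p [seq `|(const_mx 1 : 'rV[R]_d) 0 i| | i <- enum 'I_d].
  by rewrite -(orth_diag_const UtU) schatten_orth_diag.
split=> [C1|C1].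
  apply: argmin_trace_eq => [|L _] /=; last by rewrite mul0mx mxtrace0.
  have -> : 0 *m X - 1%:M = orth_diag U (- const_mx 1).
    rewrite mul0mx sub0r -(orth_diag_const UtU) /orth_diag raddfN /=.
    by rewrite mulmxN mulNmx.
  rewrite schatten_orth_diag //; apply: le_trans C1; rewrite schatten1.
  by under eq_map do rewrite mxE normrN.
have out1 : ~ lp_ball p C (const_mx 1 : 'rV[R]_d).
  by rewrite /lp_ball /= -schatten1; apply/negP; rewrite -ltNge.
have [e crit] := critical_exists s0 p1 C0.
set sg := fun i => sigma 0 i in crit.
have w0 := weight_gt0 s0 p1 C0 crit out1.
have [bias estE] := bias_constrained_critical UtU GE p1 C0 s0 crit.
set w := \row_i _ in bias estE.
pose v : 'rV[R]_d := \row_i (weight sg e i)^-1.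
have [Ghu GhV] : orth_diag U v \in unitmx /\ invmx (orth_diag U v) = orth_diag U w.
  by apply: orth_diag_inv => // i; rewrite !mxE mulVf // gt_eqF.
have normE : schatten_norm p (invmx (orth_diag U v) *m G - 1%:M) =
    lp_norm p [seq `|e 0 i| | i <- enum 'I_d].
  rewrite GhV bias schatten_orth_diag //; congr lp_norm.
  by apply: eq_map => i; rewrite mxE normrN.
exists (orth_diag U v); split; [split|split].
- exact: Ghu.
- by rewrite GhV.
- exact: tr_orth_diag.
(* The library diagonalises by [P A P^-1], with eigenvectors as rows, hence [U^T]. *)
- exists U^T; first by rewrite unitmx_tr; case: (mulmx1_unit UtU).
  have diag u : diagonalizable_for U^T (orth_diag U u).
    have Utu : U^T \in unitmx by case: (mulmx1_unit UtU).
    apply/diagonalizable_forP => // i j /negPf ij.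
    rewrite (_ : invmx U^T = U); last by rewrite -[RHS](mulKmx Utu) UtU mulmx1.
    by rewrite orth_diagK // mxE (ij : (i == j) = false) mulr0n.
  apply/allP => A; rewrite !inE GE => /orP[]/eqP ->; exact: diag.
- rewrite /loewner_le GE orth_diagB; apply: orth_diag_nonneg => // i.
  rewrite !mxE subr_ge0 -[leLHS]invrK lef_pV2 ?posrE ?invr_gt0 //.
  exact: (weight_le s0 p1 C0 crit out1 i).
- move=> pE; subst p; have [[a a0 aE] nE] := critical_1 s0 C0 crit out1.
  exists a; split; [by []| |by rewrite normE].
  by congr (orth_diag U _); apply/rowP => i; rewrite !mxE aE.
- move=> pE; subst p; have [[a a0 aE] nE] := critical_2 s0 C0 crit out1.
  exists a; split; [by []| |by rewrite normE].
  rewrite GE -(orth_diag_const UtU) orth_diagD; congr orth_diag.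
  by apply/rowP => i; rewrite !mxE aE.
- move=> pE; subst p; have [eE nE] := critical_oo s0 C0 crit out1.
  have i0 := not_lp_ball_ord C0 p1 out1.
  have /andP[_] := critical_lt1 s0 p1 C0 crit out1 i0; rewrite eE => Clt1.
  (* Since [e_i = C < 1], [1 / w_i = sigma_i / (1 - C)], so [1 + alpha = 1 / (1 - C)]. *)
  exists ((1 - C)^-1 - 1); split; last by rewrite normE.
    by rewrite subr_ge0 invf_ge1 ?subr_gt0 // gerBl.
  rewrite addrC subrK GE -orth_diagZ; congr orth_diag.
  by apply/rowP => i; rewrite !mxE /weight eE invf_div mulrC.
Qed.
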